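(* Let $\mathcal{Q}$ be a small quantaloid. For a 2-functor $\mathcal{T}:\mathcal{Q}\text{-}\mathbf{Cat}\to\mathcal{Q}\text{-}\mathbf{Cat}$, the following assertions are equivalent: (i) $\mathcal{T}\mathsf{y}_X$ is a fully faithful $\mathcal{Q}$-functor, for every $\mathcal{Q}$-category $X$; (ii) $\overline{\mathcal{T}}$ is a flat lax extension of $\mathcal{T}$ to $\mathcal{Q}\text{-}\mathbf{Dist}$; (iii) $\mathcal{T}$ admits some flat lax extension to $\mathcal{Q}\text{-}\mathbf{Dist}$; (iv) $\mathcal{T}$ admits a unique flat lax extension to $\mathcal{Q}\text{-}\mathbf{Dist}$.
   Context: A quantaloid $\mathcal{Q}$ is a category whose hom-sets are complete lattices such that composition preserves arbitrary suprema in each variable; $\mathcal{Q}_0=\mathrm{ob}\,\mathcal{Q}$. For $\alpha:p\to q,\beta:q\to r,\gamma:p\to r$: $\alpha\le\beta\searrow\gamma\iff\beta\circ\alpha\le\gamma\iff\beta\le\gamma\swarrow\alpha$; the same notation is used in $\mathcal{Q}\text{-}\mathbf{Dist}$ below. A $\mathcal{Q}$-relation $r:X\nrightarrow Y$ between sets over $\mathcal{Q}_0$ (sets with a type map $|\cdot|$ to $\mathcal{Q}_0$) is a family of morphisms $r(x,y):|x|\to|y|$ in $\mathcal{Q}$; $(s\circ r)(x,z)=\bigvee_y s(y,z)\circ r(x,y)$; the identity is $1_X^\circ$ with $1_X^\circ(x,x)=1_{|x|}$ and $1_X^\circ(x,y)=\bot$ for $x\ne y$; order pointwise. A $\mathcal{Q}$-category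 is $(X,a)$ with $a:X\nrightarrow X$, $1_X^\circ\le a$, $a\circ a\le a$. A $\mathcal{Q}$-functor $f:(X,a)\to(Y,b)$ is a type-preserving map with $a(x,x')\le b(fx,fx')$; it is fully faithful if equality always holds; $f\le g$ iff $1_{|x|}\le b(fx,gx)$ for all $x$. This gives the 2-category $\mathcal{Q}\text{-}\mathbf{Cat}$; a 2-functor on it is a functor monotone on homs. A $\mathcal{Q}$-distributor $\varphi:(X,a)\nrightarrow(Y,b)$ is a $\mathcal{Q}$-relation with $b\circ\varphi\circ a\le\varphi$; these form the quantaloid $\mathcal{Q}\text{-}\mathbf{Dist}$ with composition and order as for $\mathcal{Q}$-relations and identity $1^*_{(X,a)}=a$. For a $\mathcal{Q}$-functor $f:(X,a)\to(Y,b)$: $f_*:X\nrightarrow Y$, $f_*(x,y)=b(fx,y)$, and $f^*:Y\nrightarrow X$, $f^*(y,x)=b(y,fx)$. $\mathcal{P}X$ is the $\mathcal{Q}$-category of distributors $\sigma:X\nrightarrow\{s\}$, $s\in\mathcal{Q}_0$ ($\{s\}$ is the one-object $\mathcal{Q}$-category of type $s$ with hom $1_s$), with $|\sigma|=s$ and hom $1^*_{\mathcal{P}X}(\sigma,\tau)=\tau\swarrow\sigma$. The Yoneda functor is $\mathsf{y}_X:X\to\mathcal{P}X$, $x\mapsto a(-,x)$. For a distributor $\varphi:X\nrightarrow Y$, $\overleftarrow{\varphi}:Y\to\mathcal{P}X$ is the $\mathcal{Q}$-functor $y\mapsto\varphi(-,y)$. A lax extension of $\mathcal{T}$ to $\mathcal{Q}\text{-}\mathbf{Dist}$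 is a lax 2-functor $\hat{\mathcal{T}}:\mathcal{Q}\text{-}\mathbf{Dist}\to\mathcal{Q}\text{-}\mathbf{Dist}$ (monotone on homs, $1^*_{\hat{\mathcal{T}}X}\le\hat{\mathcal{T}}1_X^*$, $\hat{\mathcal{T}}\psi\circ\hat{\mathcal{T}}\varphi\le\hat{\mathcal{T}}(\psi\circ\varphi)$) agreeing with $\mathcal{T}$ on objects with $(\mathcal{T}f)_*\le\hat{\mathcal{T}}(f_* )$ and $(\mathcal{T}f)^*\le\hat{\mathcal{T}}(f^* )$ for all $\mathcal{Q}$-functors $f$; it is flat if these two inequalities are always equalities. Finally, $\overline{\mathcal{T}}X=\mathcal{T}X$ and $\overline{\mathcal{T}}\varphi:=(\mathcal{T}\overleftarrow{\varphi})^*\circ(\mathcal{T}\mathsf{y}_X)_*$ for every distributor $\varphi:X\nrightarrow Y$. *)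

(* Defs.v *)
From Stdlib Require Import Setoid.

Set Implicit Arguments.
Unset Strict Implicit.
Unset Printing Implicit Defensive.

(* Suprema are taken over subsets of a hom-set, encoded as predicates;
   [qcomp beta alpha] is beta after alpha. *)
Record Quantaloid := {
  qob :> Type;
  qhom : qob -> qob -> Type;
  qid : forall p, qhom p p;
  qcomp : forall p q r, qhom q r -> qhom p q -> qhom p r;
  qle : forall p q, qhom p q -> qhom p q -> Prop;
  qsup : forall p q, (qhom p q -> Prop) -> qhom p q;
  qcompA : forall p q r s (h : qhom r s) (g : qhom q r) (f : qhom p q),
    qcomp h (qcomp g f) = qcomp (qcomp h g) f;
  qcomp1l : forall p q (f : qhom p q), qcomp (qid q) f = f;
  qcomp1r : forall p q (f : qhom p q), qcomp f (qid p) = f;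
  qle_refl : forall p q (f : qhom p q), qle f f;
  qle_trans : forall p q (f g h : qhom p q), qle f g -> qle g h -> qle f h;
  qle_antisym : forall p q (f g : qhom p q), qle f g -> qle g f -> f = g;
  qsup_ub : forall p q (A : qhom p q -> Prop) f, A f -> qle f (qsup A);
  qsup_least : forall p q (A : qhom p q -> Prop) g,
    (forall f, A f -> qle f g) -> qle (qsup A) g;
  qcomp_supl : forall p q r (B : qhom q r -> Prop) (f : qhom p q),
    qcomp (qsup B) f = qsup (fun h => exists2 g, B g & h = qcomp g f);
  qcomp_supr : forall p q r (g : qhom q r) (A : qhom p q -> Prop),
    qcomp g (qsup A) = qsup (fun h => exists2 f, A f & h = qcomp g f)
}.

Arguments qid {_} _.
Declare Scope quantaloid_scope.
Delimit Scope quantaloid_scope with Q.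
Notation "g \oq f" := (qcomp g f) (at level 40, left associativity)
  : quantaloid_scope.
Notation "f <=q g" := (qle f g) (at level 70, no associativity)
  : quantaloid_scope.
Local Open Scope quantaloid_scope.

Lemma qcomp_monol (Q : Quantaloid) (p q r : Q) (g g' : qhom q r) (f : qhom p q) :
  g <=q g' -> g \oq f <=q g' \oq f.
Proof.
intros H.
assert (E : g' = qsup (fun k => k = g \/ k = g')).
{ apply qle_antisym.
  - apply qsup_ub; right; reflexivity.
  - apply qsup_least; intros k [-> | ->]; [exact H | apply qle_refl]. }
rewrite E, qcomp_supl; apply qsup_ub; exists g; [left|]; reflexivity.
Qed.

Lemma qcomp_monor (Q : Quantaloid) (p q r : Q) (g : qhom q r) (f f' : qhom p q) :
  f <=q f' -> g \oq f <=q g \oq f'.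
Proof.
intros H.
assert (E : f' = qsup (fun k => k = f \/ k = f')).
{ apply qle_antisym.
  - apply qsup_ub; right; reflexivity.
  - apply qsup_least; intros k [-> | ->]; [exact H | apply qle_refl]. }
rewrite E, qcomp_supr; apply qsup_ub; exists f; [left|]; reflexivity.
Qed.

(* A set over the objects of Q is given by the fibres of its type map:
   [X p] consists of the elements of type p. *)
Notation QSet Q := (qob Q -> Type).
Notation QRel X Y := (forall p q, X p -> Y q -> qhom p q).

Section Relations.
Variable Q : Quantaloid.
Implicit Types X Y Z W : QSet Q.

Definition rel_le X Y (r s : QRel X Y) : Prop :=
  forall p q (x : X p) (y : Y q), r p q x y <=q s p q x y.

Definition rel_comp X Y Z (s : QRel Y Z) (r : QRel X Y) : QRel X Z :=
  fun p t x z =>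
    qsup (fun h => exists q (y : Y q), h = s q t y z \oq r p q x y).

(* [id_graph x y f] holds iff x and y are the same element and f is the
   identity of its type; its supremum is therefore the identity if x = y and
   bottom otherwise. *)
Inductive id_graph X p (x : X p) : forall q, X q -> qhom p q -> Prop :=
  id_graph_refl : id_graph x x (qid p).

Definition rel_id X : QRel X X := fun p q x y => qsup (id_graph x (q:=q) y).

Lemma rel_le_refl X Y (r : QRel X Y) : rel_le r r.
Proof. intros p q x y; apply qle_refl. Qed.

Lemma rel_le_trans X Y (r s t : QRel X Y) :
  rel_le r s -> rel_le s t -> rel_le r t.
Proof. intros H K p q x y; exact (qle_trans (H p q x y) (K p q x y)). Qed.

Lemma rel_comp_ub X Y Z (s : QRel Y Z) (r : QRel X Y) p q t
    (x : X p) (y : Y q) (z : Z t) :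
  s q t y z \oq r p q x y <=q rel_comp s r x z.
Proof. apply qsup_ub; exists q, y; reflexivity. Qed.

Lemma rel_comp_least X Y Z (s : QRel Y Z) (r : QRel X Y) (u : QRel X Z) :
  (forall p q t (x : X p) (y : Y q) (z : Z t),
     s q t y z \oq r p q x y <=q u p t x z) ->
  rel_le (rel_comp s r) u.
Proof. intros H p t x z; apply qsup_least; intros f (q & y & ->); apply H. Qed.

Lemma rel_comp_mono X Y Z (s s' : QRel Y Z) (r r' : QRel X Y) :
  rel_le s s' -> rel_le r r' -> rel_le (rel_comp s r) (rel_comp s' r').
Proof.
intros Hs Hr; apply rel_comp_least; intros p q t x y z.
eapply qle_trans; [apply qcomp_monol, Hs|].
eapply qle_trans; [apply qcomp_monor, Hr | apply rel_comp_ub].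
Qed.

Lemma rel_compA1 X Y Z W (t : QRel Z W) (s : QRel Y Z) (r : QRel X Y) :
  rel_le (rel_comp t (rel_comp s r)) (rel_comp (rel_comp t s) r).
Proof.
apply rel_comp_least; intros p q u x z w; unfold rel_comp at 1.
rewrite qcomp_supr; apply qsup_least; intros h [f (v & y & ->) ->].
rewrite qcompA.
eapply qle_trans; [apply qcomp_monol, rel_comp_ub|].
exact (rel_comp_ub (rel_comp t s) r x y w).
Qed.

Lemma rel_compA2 X Y Z W (t : QRel Z W) (s : QRel Y Z) (r : QRel X Y) :
  rel_le (rel_comp (rel_comp t s) r) (rel_comp t (rel_comp s r)).
Proof.
apply rel_comp_least; intros p q u x y w; unfold rel_comp at 1.
rewrite qcomp_supl; apply qsup_least; intros h [f (v & z & ->) ->].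
rewrite <- qcompA.
eapply qle_trans; [apply qcomp_monor, rel_comp_ub|].
exact (rel_comp_ub t (rel_comp s r) x z w).
Qed.

Lemma rel_id_leP X (a : QRel X X) :
  rel_le (@rel_id X) a <-> forall p (x : X p), qid p <=q a p p x x.
Proof.
split; intros H.
- intros p x; eapply qle_trans; [|apply H].
  apply qsup_ub; constructor.
- intros p q x y; apply qsup_least; intros f []; apply H.
Qed.

End Relations.

Record QCat (Q : Quantaloid) := {
  cob :> QSet Q;
  chom : QRel cob cob;
  chom_refl : rel_le (@rel_id Q cob) chom;
  chom_trans : rel_le (rel_comp chom chom) chom
}.
Arguments chom {Q} _ {p q} _ _ : rename.

Section Categories.
Variable Q : Quantaloid.
Implicit Types X Y Z : QCat Q.

Lemma chom1 X p (x : X p) : qid p <=q chom X x x.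
Proof. apply (proj1 (rel_id_leP (@chom Q X))), chom_refl. Qed.

Lemma chomM X p q r (x : X p) (y : X q) (z : X r) :
  chom X y z \oq chom X x y <=q chom X x z.
Proof.
eapply qle_trans; [|apply chom_trans].
exact (rel_comp_ub (@chom Q X) (@chom Q X) x y z).
Qed.

Record QFun X Y := {
  fmap :> forall p, X p -> Y p;
  fmap_le : forall p q (x : X p) (x' : X q),
    chom X x x' <=q chom Y (fmap x) (fmap x')
}.

Definition fully_faithful X Y (f : QFun X Y) : Prop :=
  forall p q (x : X p) (x' : X q), chom X x x' = chom Y (f p x) (f q x').

Definition fun_le X Y (f g : QFun X Y) : Prop :=
  forall p (x : X p), qid p <=q chom Y (f p x) (g p x).

Definition fun_id X : QFun X X :=
  {| fmap := fun p (x : X p) => x; fmap_le := fun p q x x' => qle_refl _ |}.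

Definition fun_comp X Y Z (g : QFun Y Z) (f : QFun X Y) : QFun X Z :=
  {| fmap := fun p (x : X p) => g p (f p x);
     fmap_le := fun p q x x' =>
       qle_trans (fmap_le f x x') (fmap_le g (f p x) (f q x')) |}.

Record Dist X Y := {
  drel :> QRel X Y;
  drelP : rel_le (rel_comp (@chom Q Y) (rel_comp drel (@chom Q X))) drel
}.

Definition dist_le X Y (phi psi : Dist X Y) : Prop := rel_le phi psi.

Lemma dist_intro X Y (r : QRel X Y) :
  (forall p q p' q' (x' : X p') (x : X p) (y : Y q) (y' : Y q'),
     chom Y y y' \oq (r p q x y \oq chom X x' x) <=q r p' q' x' y') ->
  rel_le (rel_comp (@chom Q Y) (rel_comp r (@chom Q X))) r.
Proof.
intros H; apply rel_comp_least; intros p q t x y z; unfold rel_comp.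
rewrite qcomp_supr; apply qsup_least; intros h [f (u & x' & ->) ->]; apply H.
Qed.

Lemma dist_act X Y (phi : Dist X Y) p q p' q'
    (x' : X p') (x : X p) (y : Y q) (y' : Y q') :
  chom Y y y' \oq (phi p q x y \oq chom X x' x) <=q phi p' q' x' y'.
Proof.
eapply qle_trans; [|apply drelP].
eapply qle_trans; [apply qcomp_monor, rel_comp_ub|].
exact (rel_comp_ub (@chom Q Y) (rel_comp phi (@chom Q X)) x' y y').
Qed.

Lemma dist_actr X Y (phi : Dist X Y) p q p' (x' : X p') (x : X p) (y : Y q) :
  phi p q x y \oq chom X x' x <=q phi p' q x' y.
Proof.
eapply qle_trans; [|apply (dist_act phi x' x y y)].
rewrite <- (qcomp1l (phi p q x y \oq chom X x' x)) at 1.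
apply qcomp_monol, chom1.
Qed.

Lemma dist_actl X Y (phi : Dist X Y) p q q' (x : X p) (y : Y q) (y' : Y q') :
  chom Y y y' \oq phi p q x y <=q phi p q' x y'.
Proof.
eapply qle_trans; [|apply (dist_act phi x x y y')].
rewrite <- (qcomp1r (phi p q x y)) at 1.
apply qcomp_monor, qcomp_monor, chom1.
Qed.

Lemma dist_id_subproof X :
  rel_le (rel_comp (@chom Q X) (rel_comp (@chom Q X) (@chom Q X))) (@chom Q X).
Proof.
apply dist_intro; intros.
eapply qle_trans; [apply qcomp_monor, chomM | apply chomM].
Qed.

Definition dist_id X : Dist X X := {| drelP := @dist_id_subproof X |}.

Lemma dist_comp_subproof X Y Z (psi : Dist Y Z) (phi : Dist X Y) :
  rel_le (rel_comp (@chom Q Z) (rel_comp (rel_comp psi phi) (@chom Q X)))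
         (rel_comp psi phi).
Proof.
apply dist_intro; intros p q p' q' x' x z z'; unfold rel_comp at 1.
rewrite qcomp_supl, qcomp_supr; apply qsup_least.
intros h [k [l (r & y & ->) ->] ->].
rewrite <- qcompA, qcompA.
eapply qle_trans; [apply qcomp_monol, dist_actl|].
eapply qle_trans; [apply qcomp_monor, dist_actr|].
exact (rel_comp_ub psi phi x' y z').
Qed.

Definition dist_comp X Y Z (psi : Dist Y Z) (phi : Dist X Y) : Dist X Z :=
  {| drelP := @dist_comp_subproof X Y Z psi phi |}.

Lemma dist_sup_subproof X Y (A : Dist X Y -> Prop) :
  let r : QRel X Y := fun p q x y =>
    qsup (fun h => exists2 phi : Dist X Y, A phi & h = phi p q x y) in
  rel_le (rel_comp (@chom Q Y) (rel_comp r (@chom Q X))) r.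
Proof.
intros r; apply dist_intro; intros p q p' q' x' x y y'; unfold r at 1.
rewrite qcomp_supl, qcomp_supr; apply qsup_least.
intros h [k [l [phi Aphi ->] ->] ->].
eapply qle_trans; [apply dist_act|].
apply qsup_ub; exists phi; [exact Aphi | reflexivity].
Qed.

Definition dist_sup X Y (A : Dist X Y -> Prop) : Dist X Y :=
  {| drelP := @dist_sup_subproof X Y A |}.

(* The residual of gamma along alpha (gamma "south-west arrow" alpha), i.e.
   the largest beta such that beta after alpha is below gamma. *)
Definition dist_swarrow X Y Z (gamma : Dist X Z) (alpha : Dist X Y) : Dist Y Z :=
  dist_sup (fun beta => dist_le (dist_comp beta alpha) gamma).

Lemma dist_swarrowP X Y Z (gamma : Dist X Z) (alpha : Dist X Y) (beta : Dist Y Z) :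
  dist_le (dist_comp beta alpha) gamma <->
  dist_le beta (dist_swarrow gamma alpha).
Proof.
split; intros H.
- intros p q x y; apply qsup_ub; exists beta; [exact H | reflexivity].
- eapply rel_le_trans; [apply rel_comp_mono; [exact H | apply rel_le_refl]|].
  apply rel_comp_least; intros p q t x y z; simpl.
  rewrite qcomp_supl; apply qsup_least; intros h [k [b Hb ->] ->].
  eapply qle_trans; [|apply Hb]; exact (rel_comp_ub b alpha x y z).
Qed.

Lemma fun_lower_subproof X Y (f : QFun X Y) :
  let r : QRel X Y := fun p q x y => chom Y (f p x) y in
  rel_le (rel_comp (@chom Q Y) (rel_comp r (@chom Q X))) r.
Proof.
intros r; apply dist_intro; intros p q p' q' x' x y y'.
eapply qle_trans; [apply qcomp_monor, qcomp_monor, (fmap_le f)|].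
eapply qle_trans; [apply qcomp_monor, chomM | apply chomM].
Qed.

Definition fun_lower X Y (f : QFun X Y) : Dist X Y :=
  {| drelP := @fun_lower_subproof X Y f |}.

Lemma fun_upper_subproof X Y (f : QFun X Y) :
  let r : QRel Y X := fun p q y x => chom Y y (f q x) in
  rel_le (rel_comp (@chom Q X) (rel_comp r (@chom Q Y))) r.
Proof.
intros r; apply dist_intro; intros p q p' q' y' y x x'.
eapply qle_trans; [apply qcomp_monol, (fmap_le f)|].
eapply qle_trans; [apply qcomp_monor, chomM | apply chomM].
Qed.

Definition fun_upper X Y (f : QFun X Y) : Dist Y X :=
  {| drelP := @fun_upper_subproof X Y f |}.

Inductive single_ob (s : Q) : Q -> Type := pt : single_ob s s.

Definition single_arrow (s t : Q) (f : qhom s t) :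
    QRel (single_ob s) (single_ob t) :=
  fun p q x y =>
    match x in single_ob _ p', y in single_ob _ q' return qhom p' q' with
    | pt _, pt _ => f
    end.

Lemma single_refl (s : Q) : rel_le (@rel_id Q (single_ob s)) (single_arrow (qid s)).
Proof. apply rel_id_leP; intros p []; apply qle_refl. Qed.

Lemma single_trans (s : Q) :
  rel_le (rel_comp (single_arrow (qid s)) (single_arrow (qid s)))
         (single_arrow (qid s)).
Proof.
apply rel_comp_least; intros p q t [] [] []; simpl.
rewrite qcomp1l; apply qle_refl.
Qed.

Definition single (s : Q) : QCat Q :=
  {| chom_refl := @single_refl s; chom_trans := @single_trans s |}.

Lemma single_dist_subproof (s t : Q) (f : qhom s t) :
  rel_le (rel_comp (@chom Q (single t))
            (rel_comp (single_arrow f) (@chom Q (single s))))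
         (single_arrow f).
Proof.
apply (@dist_intro (single s) (single t)); intros p q p' q' [] [] [] []; simpl.
rewrite qcomp1l, qcomp1r; apply qle_refl.
Qed.

Definition single_dist (s t : Q) (f : qhom s t) : Dist (single s) (single t) :=
  {| drelP := single_dist_subproof f |}.

(* The column phi(-,y) of phi. *)
Lemma dist_col_subproof X Y (phi : Dist X Y) q (y : Y q) :
  let r : QRel X (single q) := fun p _ x u =>
    match u in single_ob _ q' return qhom p q' with pt _ => phi p q x y end in
  rel_le (rel_comp (@chom Q (single q)) (rel_comp r (@chom Q X))) r.
Proof.
intros r; apply (@dist_intro X (single q)); intros p t p' t' x' x [] []; simpl.
rewrite qcomp1l; apply dist_actr.
Qed.

Definition dist_col X Y (phi : Dist X Y) q (y : Y q) : Dist X (single q) :=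
  {| drelP := @dist_col_subproof X Y phi q y |}.

Definition psh_ob X : QSet Q := fun s => Dist X (single s).

Definition psh_hom X : QRel (psh_ob X) (psh_ob X) :=
  fun s t sigma tau => dist_swarrow tau sigma s t (pt s) (pt t).

Lemma psh_hom_intro X s t (sigma : psh_ob X s) (tau : psh_ob X t) (f : qhom s t) :
  (forall p (x : X p), f \oq sigma p s x (pt s) <=q tau p t x (pt t)) ->
  f <=q psh_hom sigma tau.
Proof.
intros H.
apply (proj1 (dist_swarrowP tau sigma (single_dist f))) with (x := pt s) (y := pt t).
apply rel_comp_least; intros p q r x [] []; apply H.
Qed.

Lemma psh_refl X : rel_le (@rel_id Q (psh_ob X)) (@psh_hom X).
Proof.
apply rel_id_leP; intros s sigma; apply psh_hom_intro; intros p x.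
rewrite qcomp1l; apply qle_refl.
Qed.

Lemma dist_swarrow_trans X Y Z W (ups : Dist X W) (tau : Dist X Z)
    (sigma : Dist X Y) :
  dist_le (dist_comp (dist_swarrow ups tau) (dist_swarrow tau sigma))
          (dist_swarrow ups sigma).
Proof.
apply (proj1 (dist_swarrowP _ _ _)).
refine (rel_le_trans
  (rel_compA2 (dist_swarrow ups tau) (dist_swarrow tau sigma) sigma) _).
refine (rel_le_trans (rel_comp_mono (rel_le_refl (dist_swarrow ups tau))
  (proj2 (dist_swarrowP tau sigma _) (rel_le_refl (dist_swarrow tau sigma)))) _).
exact (proj2 (dist_swarrowP ups tau _) (rel_le_refl (dist_swarrow ups tau))).
Qed.

Lemma psh_trans X : rel_le (rel_comp (@psh_hom X) (@psh_hom X)) (@psh_hom X).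
Proof.
apply rel_comp_least; intros s t u sigma tau ups.
eapply qle_trans;
  [exact (rel_comp_ub (dist_swarrow ups tau) (dist_swarrow tau sigma)
            (pt s) (pt t) (pt u))|].
apply (@dist_swarrow_trans X (single s) (single t) (single u) ups tau sigma).
Qed.

Definition psh X : QCat Q :=
  {| chom_refl := @psh_refl X; chom_trans := @psh_trans X |}.

Lemma dist_transpose_subproof X Y (phi : Dist X Y) p q (y : Y p) (y' : Y q) :
  chom Y y y' <=q chom (psh X) (dist_col phi y) (dist_col phi y').
Proof. apply psh_hom_intro; intros r x; exact (dist_actl phi x y y'). Qed.

Definition dist_transpose X Y (phi : Dist X Y) : QFun Y (psh X) :=
  {| fmap := fun q y => dist_col phi y : psh X q;
     fmap_le := @dist_transpose_subproof X Y phi |}.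

(* x |-> a(-,x) is the transpose of the identity distributor a of (X,a). *)
Definition yoneda X : QFun X (psh X) := dist_transpose (dist_id X).

End Categories.

Record TwoFunctor (Q : Quantaloid) := {
  tob :> QCat Q -> QCat Q;
  tfun : forall X Y : QCat Q, QFun X Y -> QFun (tob X) (tob Y);
  tfun_id : forall X : QCat Q, tfun (fun_id X) = fun_id (tob X);
  tfun_comp : forall (X Y Z : QCat Q) (g : QFun Y Z) (f : QFun X Y),
    tfun (fun_comp g f) = fun_comp (tfun g) (tfun f);
  tfun_mono : forall (X Y : QCat Q) (f g : QFun X Y),
    fun_le f g -> fun_le (tfun f) (tfun g)
}.

Section LaxExtensions.
Variables (Q : Quantaloid) (T : TwoFunctor Q).

(* Agreement with T on objects is built into the type of the action on
   distributors. *)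
Definition DistAction :=
  forall X Y : QCat Q, Dist X Y -> Dist (T X) (T Y).

Record lax_extension (hT : DistAction) : Prop := {
  lax_mono : forall X Y (phi psi : Dist X Y),
    dist_le phi psi -> dist_le (hT X Y phi) (hT X Y psi);
  lax_id : forall X, dist_le (dist_id (T X)) (hT X X (dist_id X));
  lax_comp : forall X Y Z (psi : Dist Y Z) (phi : Dist X Y),
    dist_le (dist_comp (hT Y Z psi) (hT X Y phi)) (hT X Z (dist_comp psi phi));
  lax_lower : forall X Y (f : QFun X Y),
    dist_le (fun_lower (tfun T f)) (hT X Y (fun_lower f));
  lax_upper : forall X Y (f : QFun X Y),
    dist_le (fun_upper (tfun T f)) (hT Y X (fun_upper f))
}.

Record flat_lax_extension (hT : DistAction) : Prop := {
  flat_lax :> lax_extension hT;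
  flat_lower : forall X Y (f : QFun X Y),
    fun_lower (tfun T f) = hT X Y (fun_lower f);
  flat_upper : forall X Y (f : QFun X Y),
    fun_upper (tfun T f) = hT Y X (fun_upper f)
}.

Definition bar_extension : DistAction := fun X Y phi =>
  dist_comp (fun_upper (tfun T (dist_transpose phi)))
            (fun_lower (tfun T (yoneda X))).

End LaxExtensions.

(* Main.v *)
(* Composing a lower with an upper distributor amounts to evaluating a hom, so
   bar T phi (x, y) is the hom in T(PX) from (T y_X) x to (T phi-transpose) y.
   Since the transpose of psi o phi is the transpose of psi followed by
   precomposition with phi, a functor PY -> PX, laxness of bar T is automatic.
   Full faithfulness of T y gives flatness: the transpose of f^* is y_Y o f, and
   the transpose of f_* is y_Y followed by the right adjoint of the functor
   PX -> PY extending y_Y o f along y_X.  Conversely, any flat lax extension is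
   determined by its values on the functors in the Yoneda factorisation
   phi = (phi-transpose)^* o (y_X)_*, hence equals bar T, and its value at the
   identity distributor shows that T y is fully faithful. *)
From Stdlib Require Import FunctionalExtensionality ProofIrrelevance.
Require Import Defs.

Local Open Scope quantaloid_scope.

(** * Extensionality, the distributors induced by functors, and adjunctions *)

Section DistributorCalculus.
Context {Q : Quantaloid}.
Implicit Types X Y Z : QCat Q.

Lemma dist_ext X Y (phi psi : Dist X Y) :
  (forall p q (x : X p) (y : Y q), phi p q x y = psi p q x y) -> phi = psi.
Proof.
destruct phi as [r Hr], psi as [s Hs]; simpl; intros E.
assert (r = s) as <-.
{ do 4 (apply functional_extensionality_dep; intro); apply E. }
f_equal; apply proof_irrelevance.
Qed.

Lemma dist_le_antisym X Y (phi psi : Dist X Y) :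
  dist_le phi psi -> dist_le psi phi -> phi = psi.
Proof.
intros H K; apply dist_ext; intros p q x y.
apply qle_antisym; [apply H | apply K].
Qed.

Lemma fun_ext X Y (f g : QFun X Y) :
  (forall p (x : X p), f p x = g p x) -> f = g.
Proof.
destruct f as [f Hf], g as [g Hg]; simpl; intros E.
assert (f = g) as <-.
{ do 2 (apply functional_extensionality_dep; intro); apply E. }
f_equal; apply proof_irrelevance.
Qed.

Lemma dist_comp1l X Y (phi : Dist X Y) : dist_comp (dist_id Y) phi = phi.
Proof.
apply dist_le_antisym.
- apply rel_comp_least; intros; apply dist_actl.
- intros p q x y.
  eapply qle_trans; [|exact (rel_comp_ub (dist_id Y) phi x y y)].
  rewrite <- (qcomp1l (phi p q x y)) at 1; apply qcomp_monol, chom1.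
Qed.

(** The supremum is attained at the middle element [h p x], where the lower factor dominates an
    identity; transitivity in [Z] bounds the other terms. *)
Lemma dist_comp_upper_lower X Y Z (g : QFun Y Z) (h : QFun X Z) p q
    (x : X p) (y : Y q) :
  dist_comp (fun_upper g) (fun_lower h) p q x y = chom Z (h p x) (g q y).
Proof.
apply qle_antisym.
- apply qsup_least; intros k (r & z & ->); apply chomM.
- eapply qle_trans;
    [|exact (rel_comp_ub (fun_upper g) (fun_lower h) x (h p x) y)].
  simpl; rewrite <- (qcomp1r (chom Z (h p x) (g q y))) at 1.
  apply qcomp_monor, chom1.
Qed.

Lemma fun_upper_mono X Y (f g : QFun X Y) :
  fun_le f g -> dist_le (fun_upper f) (fun_upper g).
Proof.
intros H q p y x; simpl.
rewrite <- (qcomp1l (chom Y y (f p x))).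
eapply qle_trans; [apply qcomp_monol, H | apply chomM].
Qed.

Lemma dist_unit_le X Y (f : QFun X Y) :
  dist_le (dist_id X) (dist_comp (fun_upper f) (fun_lower f)).
Proof. intros p q x x'; rewrite dist_comp_upper_lower; apply fmap_le. Qed.

Lemma dist_counit_le X Y (f : QFun X Y) :
  dist_le (dist_comp (fun_lower f) (fun_upper f)) (dist_id Y).
Proof. apply rel_comp_least; intros; apply chomM. Qed.

Lemma adjoint_chom X Y (l : QFun X Y) (r : QFun Y X) :
  fun_le (fun_id X) (fun_comp r l) -> fun_le (fun_comp l r) (fun_id Y) ->
  forall p q (x : X p) (y : Y q), chom X x (r q y) = chom Y (l p x) y.
Proof.
intros unit counit p q x y; apply qle_antisym.
- eapply qle_trans; [apply (fmap_le l)|].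
  rewrite <- (qcomp1l (chom Y (l p x) (l q (r q y)))).
  eapply qle_trans; [apply qcomp_monol, counit | apply chomM].
- eapply qle_trans; [apply (fmap_le r)|].
  rewrite <- (qcomp1r (chom X (r p (l p x)) (r q y))).
  eapply qle_trans; [apply qcomp_monor, unit | apply chomM].
Qed.

(** * Presheaves and the Yoneda lemma *)

Lemma psh_hom_elim X s t (sigma : psh X s) (tau : psh X t) p (x : X p) :
  chom (psh X) sigma tau \oq sigma p s x (pt s) <=q tau p t x (pt t).
Proof.
eapply qle_trans;
  [|exact (proj2 (dist_swarrowP tau sigma _)
      (rel_le_refl (dist_swarrow tau sigma)) p t x (pt t))].
exact (rel_comp_ub (dist_swarrow tau sigma) sigma x (pt s) (pt t)).
Qed.

Lemma yoneda_lemma X p s (x : X p) (sigma : psh X s) :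
  chom (psh X) (yoneda X p x) sigma = sigma p s x (pt s).
Proof.
apply qle_antisym.
- eapply qle_trans; [|exact (psh_hom_elim X p s (yoneda X p x) sigma p x)].
  rewrite <- (qcomp1r (chom (psh X) (yoneda X p x) sigma)) at 1.
  apply qcomp_monor; exact (chom1 x).
- apply psh_hom_intro; intros r x'; exact (dist_actr sigma x' x (pt s)).
Qed.

Lemma psh_le X s (sigma tau : psh X s) :
  (forall p (x : X p), sigma p s x (pt s) <=q tau p s x (pt s)) ->
  qid s <=q chom (psh X) sigma tau.
Proof. intros H; apply psh_hom_intro; intros p x; rewrite qcomp1l; apply H. Qed.

Lemma dist_transpose_mono X Y (phi psi : Dist X Y) :
  dist_le phi psi -> fun_le (dist_transpose phi) (dist_transpose psi).
Proof. intros H q y; apply psh_le; intros p x; apply H. Qed.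

(** * Precomposition functors between presheaf categories *)

Lemma psh_pre_subproof X Y (phi : Dist X Y) s t (sigma : psh Y s) (tau : psh Y t) :
  chom (psh Y) sigma tau
    <=q chom (psh X) (dist_comp sigma phi : psh X s) (dist_comp tau phi : psh X t).
Proof.
apply psh_hom_intro; intros p x; simpl; unfold rel_comp at 1.
rewrite qcomp_supr; apply qsup_least; intros h [k (q & y & ->) ->].
rewrite qcompA.
eapply qle_trans; [apply qcomp_monol, psh_hom_elim|].
exact (rel_comp_ub tau phi x y (pt t)).
Qed.

Definition psh_pre X Y (phi : Dist X Y) : QFun (psh Y) (psh X) :=
  {| fmap := fun s (sigma : psh Y s) => dist_comp sigma phi : psh X s;
     fmap_le := psh_pre_subproof X Y phi |}.

Lemma dist_transpose_comp X Y Z (psi : Dist Y Z) (phi : Dist X Y) :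
  dist_transpose (dist_comp psi phi)
    = fun_comp (psh_pre X Y phi) (dist_transpose psi).
Proof.
apply fun_ext; intros s z; apply dist_ext; intros p q x []; reflexivity.
Qed.

Lemma dist_transpose_pre X Y (phi : Dist X Y) :
  dist_transpose phi = fun_comp (psh_pre X Y phi) (yoneda Y).
Proof.
rewrite <- (dist_comp1l X Y phi) at 1; apply dist_transpose_comp.
Qed.

Lemma dist_transpose_upper X Y (f : QFun X Y) :
  dist_transpose (fun_upper f) = fun_comp (yoneda Y) f.
Proof.
apply fun_ext; intros s x; apply dist_ext; intros p q y []; reflexivity.
Qed.

(** Precomposition reverses composites, so the adjunction between [fun_lower f] and [fun_upper f]
    makes precomposition with [fun_upper f] left adjoint to precomposition with [fun_lower f]. *)
Lemma psh_pre_unit X Y (f : QFun X Y) :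
  fun_le (fun_id (psh X))
    (fun_comp (psh_pre X Y (fun_lower f)) (psh_pre Y X (fun_upper f))).
Proof.
intros s sigma; apply psh_le; intros p x.
eapply qle_trans; [|apply (rel_compA1 sigma (fun_upper f) (fun_lower f))].
eapply qle_trans;
  [|apply (rel_comp_mono (rel_le_refl sigma) (dist_unit_le X Y f))].
eapply qle_trans; [|exact (rel_comp_ub sigma (dist_id X) x x (pt s))].
simpl; rewrite <- (qcomp1r (sigma p s x (pt s))) at 1.
apply qcomp_monor, chom1.
Qed.

Lemma psh_pre_counit X Y (f : QFun X Y) :
  fun_le (fun_comp (psh_pre Y X (fun_upper f)) (psh_pre X Y (fun_lower f)))
    (fun_id (psh Y)).
Proof.
intros s sigma; apply psh_le; intros p y.
eapply qle_trans; [apply (rel_compA2 sigma (fun_lower f) (fun_upper f))|].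
eapply qle_trans;
  [apply (rel_comp_mono (rel_le_refl sigma) (dist_counit_le X Y f))|].
apply rel_comp_least; intros; apply dist_actr.
Qed.

End DistributorCalculus.

(** * Hom formula and laxness of [bar_extension] *)

Section Extensions.
Context {Q : Quantaloid} (T : TwoFunctor Q).
Implicit Types X Y Z : QCat Q.

Lemma tfun_compE X Y Z (g : QFun Y Z) (f : QFun X Y) p (x : T X p) :
  tfun T (fun_comp g f) p x = tfun T g p (tfun T f p x).
Proof. now rewrite tfun_comp. Qed.

Lemma bar_extensionE X Y (phi : Dist X Y) p q (x : T X p) (y : T Y q) :
  bar_extension T phi p q x y
    = chom (T (psh X)) (tfun T (yoneda X) p x) (tfun T (dist_transpose phi) q y).
Proof. apply dist_comp_upper_lower. Qed.

(** A 2-functor preserves units and counits, hence adjunctions. *)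
Lemma tfun_adjoint_chom X Y (l : QFun X Y) (r : QFun Y X) :
  fun_le (fun_id X) (fun_comp r l) -> fun_le (fun_comp l r) (fun_id Y) ->
  forall p q (x : T X p) (y : T Y q),
    chom (T X) x (tfun T r q y) = chom (T Y) (tfun T l p x) y.
Proof.
intros unit counit; apply adjoint_chom.
- rewrite <- tfun_id, <- tfun_comp; apply tfun_mono, unit.
- rewrite <- tfun_id, <- tfun_comp; apply tfun_mono, counit.
Qed.

(** [T] of precomposition with [phi] carries the hom in [T (psh Y)] into [T (psh X)] and sends the
    Yoneda image of [y] to the transpose of [phi] at [y], so the two homs become composable. *)
Lemma bar_extension_comp X Y Z (psi : Dist Y Z) (phi : Dist X Y) :
  dist_le (dist_comp (bar_extension T psi) (bar_extension T phi))
          (bar_extension T (dist_comp psi phi)).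
Proof.
apply rel_comp_least; intros p q t x y z.
rewrite !bar_extensionE, dist_transpose_comp, tfun_compE.
rewrite (dist_transpose_pre X Y phi), tfun_compE.
eapply qle_trans;
  [apply qcomp_monol, (fmap_le (tfun T (psh_pre X Y phi))) | apply chomM].
Qed.

(** * Flatness from full faithfulness *)

Section FullyFaithful.
Hypothesis ff : forall X, fully_faithful (tfun T (yoneda X)).

Lemma bar_extension_lower X Y (f : QFun X Y) :
  fun_lower (tfun T f) = bar_extension T (fun_lower f).
Proof.
apply dist_ext; intros p q x y.
rewrite bar_extensionE, dist_transpose_pre, tfun_compE.
(* The adjunction moves precomposition to the left argument, where it meets the Yoneda functor and
   yields the transpose of [fun_upper f]. *)
rewrite (tfun_adjoint_chom _ _ _ _ (psh_pre_unit X Y f) (psh_pre_counit X Y f)).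
rewrite <- tfun_compE, <- dist_transpose_pre, dist_transpose_upper, tfun_compE.
apply ff.
Qed.

Lemma bar_extension_upper X Y (f : QFun X Y) :
  fun_upper (tfun T f) = bar_extension T (fun_upper f).
Proof.
apply dist_ext; intros p q y x.
rewrite bar_extensionE, dist_transpose_upper, tfun_compE; apply ff.
Qed.

Lemma bar_extension_flat : flat_lax_extension (bar_extension T).
Proof.
split; [split| |].
- intros X Y phi psi H p q x y.
  apply rel_comp_mono; [|apply rel_le_refl].
  apply fun_upper_mono, tfun_mono, dist_transpose_mono, H.
(* The transpose of the identity distributor is the Yoneda functor by definition. *)
- intros X p q x y; rewrite bar_extensionE; apply fmap_le.
- exact bar_extension_comp.
- intros X Y f; rewrite bar_extension_lower; apply rel_le_refl.
- intros X Y f; rewrite bar_extension_upper; apply rel_le_refl.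
- exact bar_extension_lower.
- exact bar_extension_upper.
Qed.

End FullyFaithful.

(** * Uniqueness, and full faithfulness from flatness *)

Lemma flat_lax_extension_bar (hT : DistAction T) :
  flat_lax_extension hT -> hT = bar_extension T.
Proof.
intros [lax lower upper].
do 3 (apply functional_extensionality_dep; intro).
rename x into X, x0 into Y, x1 into phi.
set (g := dist_transpose phi).
apply dist_le_antisym.
- intros p q x y; rewrite bar_extensionE; fold g.
  (* Read as a value of a lower distributor, the hom can be rewritten by flatness. *)
  change (chom _ _ _)
    with (fun_lower (tfun T (yoneda X)) p q x (tfun T g q y)).
  rewrite lower.
  assert (H : dist_le (dist_comp (fun_lower g) phi) (fun_lower (yoneda X))).
  { apply rel_comp_least; intros p' q' s x' y' sigma.
    unfold fun_lower, drel; rewrite yoneda_lemma.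
    exact (psh_hom_elim X q' s (g q' y') sigma p' x'). }
  eapply qle_trans; [|apply (lax_mono lax H)].
  eapply qle_trans; [|apply (lax_comp lax)].
  rewrite <- lower.
  (* Take [tfun T g q y] as middle element: there the lower distributor dominates an identity. *)
  eapply qle_trans;
    [|exact (rel_comp_ub (fun_lower (tfun T g)) (hT X Y phi) x y (tfun T g q y))].
  rewrite <- (qcomp1l (hT X Y phi p q x y)) at 1; apply qcomp_monol, chom1.
- unfold bar_extension; rewrite lower, upper.
  eapply rel_le_trans; [apply (lax_comp lax)|].
  (* What remains is the Yoneda factorisation of [phi]. *)
  apply (lax_mono lax); intros p q x y.
  rewrite dist_comp_upper_lower, yoneda_lemma; apply qle_refl.
Qed.

Lemma bar_extension_fully_faithful :
  flat_lax_extension (bar_extension T) ->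
  forall X, fully_faithful (tfun T (yoneda X)).
Proof.
intros flat X p q x x'.
(* [fun_upper (fun_id X)] is the hom of [X]: flatness evaluates its extension to the hom of [T X],
   the hom formula to the hom between Yoneda images. *)
transitivity (bar_extension T (fun_upper (fun_id X)) p q x x').
- rewrite <- (flat_upper flat), tfun_id; reflexivity.
- rewrite bar_extensionE, dist_transpose_upper, tfun_compE, tfun_id; reflexivity.
Qed.

End Extensions.

Theorem proposition4p3 (Q : Quantaloid) (T : TwoFunctor Q) :
  ((forall X : QCat Q, fully_faithful (tfun T (yoneda X))) <->
     flat_lax_extension (bar_extension T)) /\
  (flat_lax_extension (bar_extension T) <->
     (exists hT : DistAction T, flat_lax_extension hT)) /\
  ((exists hT : DistAction T, flat_lax_extension hT) <->
     (exists! hT : DistAction T, flat_lax_extension hT)).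
Proof.
split; [|split]; split.
- apply bar_extension_flat.
- apply bar_extension_fully_faithful.
- intros flat; exists (bar_extension T); exact flat.
- intros [hT flat]; rewrite <- (flat_lax_extension_bar T hT flat); exact flat.
- intros [hT flat]; exists hT; split; [exact flat|].
  intros hT' flat'; rewrite (flat_lax_extension_bar T hT' flat').
  exact (flat_lax_extension_bar T hT flat).
- intros [hT [flat _]]; exists hT; exact flat.
Qed.
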